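(* Let $D\subseteq W$ be a Condorcet domain and let $f:D\to\mathbb{Z}_{\ge 0}$ be a voting profile on $D$. Then the result $R(f)$ under majority rule is nonempty. Moreover, if $f$ has no tie, then there exists $w\in W$ such that $I(w)=I(f)$, and $R(f)=\{w\}$ is a singleton.
   Context: Let $\Phi$ be a finite root system in a real Euclidean space (a finite set of nonzero vectors with $\Phi\cap\mathbb{R}\alpha=\{\alpha,-\alpha\}$ and $s_\alpha(\Phi)=\Phi$ for all $\alpha\in\Phi$, where $s_\alpha$ is the orthogonal reflection in $\alpha^\perp$; not necessarily crystallographic). Let $\Phi^+$ be a choice of positive roots, $\Phi^-=\Phi\setminus\Phi^+$, and let $W=W(\Phi)$ be the finite Coxeter group generated by the $s_\alpha$. For $w\in W$, the (left) inversion set is $I(w):=\{\alpha\in\Phi\mid w^{-1}\alpha\in\Phi^-\}$ (negative roots are allowed, so exactly one of $\alpha,-\alpha$ lies in $I(w)$). A set of three roots $\{\alpha,\beta,\gamma\}\subseteq\Phi$ is a root-triple if there exist real $a,b,c>0$ with $a\alpha+b\beta+c\gamma=0$. A nonempty subset $D\subseteq W$ is a Condorcet domain if there do not exist distinct $u,v,w\in D$ and a root-triple $\{\alpha,\beta,\gamma\}$ such that $\alpha,\beta\in I(u)$, $\alpha,\gamma\in I(v)$, $\beta,\gamma\in I(w)$. A voting profile on $D$ is a map $f:D\to\mathbb{Z}_{\ge0}$ that is not constantly zero. Put $f(\alpha)=\sum_{w\in D,\ \alpha\in I(w)}f(w)$ for $\alpha\in\Phi$ and $|f|=\sum_{w\in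 D}f(w)$. The preference of $f$ is $I(f):=\{\alpha\in\Phi\mid f(\alpha)\ge|f|/2\}$, and the result of $f$ under majority rule is $R(f):=\{w\in W\mid I(w)\subseteq I(f)\}$. The profile $f$ has no tie if $f(\alpha)\ne|f|/2$ for every $\alpha\in\Phi$. *)

(* Defs.v *)
From HB Require Import structures.
From mathcomp Require Import all_boot all_order all_algebra.
From mathcomp Require Import sesquilinear.
From mathcomp Require Import boolp classical_sets functions cardinality fsbigop.
From mathcomp Require Import reals.

Set Implicit Arguments.
Unset Strict Implicit.
Unset Printing Implicit Defensive.

Import Order.TTheory GRing.Theory Num.Theory.

Local Open Scope classical_set_scope.
Local Open Scope ring_scope.

(* A real Euclidean space is a finite-dimensional real vector space V with a
   symmetric positive definite bilinear form dot : {dot V for idfun}. *)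

Section RootSystems.
Context {R : realType} {V : vectType R}.

Section Reflection.
Variables (dot : {dot V for idfun}) (a : V).

Definition reflection_fun (v : V) : V :=
  v - (2 * dot v a / dot a a) *: a.

Fact reflection_fun_linear : linear reflection_fun.
Proof.
move=> k u v; rewrite /reflection_fun linearPl /= scalerBr addrACA -opprD.
by rewrite scalerA -scalerDl mulrDr mulrDl !mulrA (mulrC 2 k).
Qed.

HB.instance Definition _ :=
  GRing.isLinear.Build R V V *:%R reflection_fun reflection_fun_linear.

Definition reflection : 'End(V) := linfun reflection_fun.

Lemma reflectionE v : reflection v = v - (2 * dot v a / dot a a) *: a.
Proof. by rewrite lfunE. Qed.

End Reflection.

(* Roots are nonzero, but the system need be neither spanning nor
   crystallographic. *)
Definition root_system (dot : {dot V for idfun}) (Phi : set V) : Prop :=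
  [/\ finite_set Phi,
      ~ Phi 0,
      forall a, Phi a -> Phi `&` [set c *: a | c in [set: R]] = [set a; - a]
    & forall a, Phi a -> reflection dot a @` Phi = Phi].

(* The positive roots are those on one side of a hyperplane containing no
   root. *)
Definition positive_system (dot : {dot V for idfun}) (Phi Pos : set V) : Prop :=
  exists2 rho : V, (forall a, Phi a -> dot rho a != 0)
                 & Pos = Phi `&` [set a | 0 < dot rho a].

(* (g^-1)%VF is the two-sided inverse of g when g is injective. *)
Definition linear_group (G : set 'End(V)) : Prop :=
  [/\ forall g, G g -> lker g == 0%VS,
      G \1%VF,
      forall g h, G g -> G h -> G (g \o h)%VF
    & forall g, G g -> G (g^-1)%VF].

Definition Weyl (dot : {dot V for idfun}) (Phi : set V) : set 'End(V) :=
  smallest linear_group (reflection dot @` Phi).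

Definition inversions (Phi Pos : set V) (w : 'End(V)) : set V :=
  [set a | Phi a /\ (Phi `\` Pos) ((w^-1)%VF a)].

Definition root_triple (Phi : set V) (a b c : V) : Prop :=
  [/\ Phi a, Phi b & Phi c] /\ [/\ a <> b, a <> c & b <> c] /\
  exists x y z : R, [/\ 0 < x, 0 < y & 0 < z] /\ x *: a + y *: b + z *: c = 0.

Definition condorcet_domain (dot : {dot V for idfun}) (Phi Pos : set V)
    (D : set 'End(V)) : Prop :=
  let I := inversions Phi Pos in
  [/\ D !=set0,
      D `<=` Weyl dot Phi
    & ~ exists u v w a b c,
        [/\ D u, D v & D w] /\ [/\ u <> v, u <> w & v <> w] /\
        root_triple Phi a b c /\
        [/\ I u a /\ I u b, I v a /\ I v c & I w b /\ I w c]].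

Section Majority.
Variables (dot : {dot V for idfun}) (Phi Pos : set V).
Variables (D : set 'End(V)) (f : D -> nat).

Definition profile : Prop := exists w : D, f w <> 0%N.

(* The sums below are over sets that are finite as soon as D is included in the
   (finite) group Weyl dot Phi. *)
Definition votes (a : V) : nat :=
  \sum_(w \in [set w : D | inversions Phi Pos (val w) a]) f w.

Definition total_votes : nat := \sum_(w \in [set: D]) f w.

Definition preference : set V :=
  [set a | Phi a /\ total_votes%:R / 2 <= (votes a)%:R :> R].

Definition majority_result : set 'End(V) :=
  [set w | Weyl dot Phi w /\ inversions Phi Pos w `<=` preference].

Definition no_tie : Prop :=
  forall a, Phi a -> (votes a)%:R <> total_votes%:R / 2 :> R.

End Majority.
End RootSystems.

(* Main.v *)
Require Import Defs.
From mathcomp Require Import all_boot all_order all_algebra.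
From mathcomp Require Import sesquilinear finmap.
From mathcomp Require Import boolp classical_sets functions cardinality fsbigop.
From mathcomp Require Import reals ring zify.

Import Order.TTheory GRing.Theory Num.Theory.

Local Open Scope classical_set_scope.
Local Open Scope ring_scope.

(** Why the theorem is true.

    Suppose first that the profile has no tie, so that the preference I picks
    exactly one root of each pair a, -a.  If I contained a root-triple a, b, c,
    then any two of its roots would both have a strict majority, hence a common
    voter ([votes_pigeonhole]).  The three voters so obtained are distinct: a
    voter with all of a, b, c in its inversion set would make all three negative
    for one linear functional, although a positive combination of them is zero
    ([inversions_triple]).  This contradicts the Condorcet condition, so I is a
    [half_system]: half of the roots, containing no root-triple.

    It remains to see that half systems are exactly the inversion sets.  Let rho
    define the positive roots and suppose that I contains one of them.  Then I
    contains a simple root ([half_system_simple]): a positive root b that is not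
    simple makes an acute angle with some simple root a, and b, -a, -s_a(b) is a
    root-triple, so a or the lower positive root s_a(b) is in I as well.  Since
    s_a permutes the positive roots other than a, replacing rho by s_a(rho)
    removes a from the positive roots in I and adds none.  Iterating gives an
    element w of the Weyl group such that I lies on the negative side of
    w(rho), that is, I = I(w) ([half_system_inversions]).

    Uniqueness of w is simple transitivity on chambers
    ([inversions_sub_inj]): reflections in simple roots generate the Weyl group,
    and the deletion argument shows that a word in them which preserves
    positivity acts trivially ([word_pos_id]).  Simple roots are obtained as an
    irredundant set of generators of the cone of positive roots
    ([simple_basis]).  Uniqueness also embeds the Weyl group into the subsets of
    the finite set of roots, so that the domain is finite and the sums of votes
    are genuine ([Weyl_finite]).

    A profile with ties reduces to the first case: doubling all votes and adding
    one voter makes the total odd, and the new preference is contained in the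
    old one ([tie_break]). *)

(** * Reflections and words of reflections *)

Section EuclideanReflections.
Context {R : realType} {V : vectType R} (dot : {dot V for idfun}).
Implicit Types (a b x y z : V) (l : seq V) (c k : R).

Lemma dotC x y : dot x y = dot y x.
Proof. by have := hermC dot x y; rewrite expr0 mul1r. Qed.

Lemma dotDl x y z : dot (x + y) z = dot x z + dot y z.
Proof. exact: linearDl. Qed.

Lemma dotZl c x z : dot (c *: x) z = c * dot x z.
Proof. exact: linearZl_LR. Qed.

Lemma dotNl x z : dot (- x) z = - dot x z.
Proof. exact: linearNl. Qed.

Lemma dotDr x y z : dot z (x + y) = dot z x + dot z y.
Proof. exact: linearDr. Qed.

Lemma dotZr c x z : dot z (c *: x) = c * dot z x.
Proof. exact: linearZr. Qed.

Lemma dotNr x z : dot z (- x) = - dot z x.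
Proof. exact: linearNr. Qed.

Lemma dot_gt0 x : x <> 0 -> 0 < dot x x.
Proof. by move=> /eqP x0; apply: (@neq0_dnorm_gt0 _ _ idfun dot). Qed.

(** In the degenerate case [a = 0] the reflection is the identity. *)
Lemma reflK a : involutive (reflection dot a).
Proof.
move=> x; rewrite !reflectionE dotDl dotNl dotZl.
have [->|/eqP a0] := eqVneq a 0; first by rewrite !scaler0 !subr0.
have aa := dot_gt0 _ a0.
rewrite -addrA -opprD -scalerDl [X in X *: a](_ : _ = 0) ?scale0r ?subr0 //.
by field; rewrite gt_eqF.
Qed.

Lemma refl_self a : a <> 0 -> reflection dot a a = - a.
Proof.
move=> /dot_gt0 aa; rewrite reflectionE -mulrA divff ?gt_eqF // mulr1.
by rewrite scaler_nat mulr2n opprD addrA subrr add0r.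
Qed.

Lemma refl_adj a x y :
  dot (reflection dot a x) y = dot x (reflection dot a y).
Proof.
rewrite !reflectionE dotDl dotNl dotZl dotDr dotNr dotZr (dotC a y); ring.
Qed.

Lemma refl_iso a x y :
  dot (reflection dot a x) (reflection dot a y) = dot x y.
Proof. by rewrite refl_adj reflK. Qed.

(** An isometry conjugates the reflection in [a] to the reflection in the
    image of [a]; here the isometry is the reflection in [b]. *)
Lemma refl_conj a b x :
  reflection dot (reflection dot b a) (reflection dot b x) =
  reflection dot b (reflection dot a x).
Proof.
rewrite [LHS]reflectionE !refl_iso [reflection dot a x]reflectionE.
by rewrite [RHS]linearB [in RHS]linearZ.
Qed.

(** A word of roots acts with its last letter first, like a product of
    endomorphisms. *)
Definition word (l : seq V) (x : V) : V :=
  foldr (fun a y => reflection dot a y) x l.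

Lemma word_cat l1 l2 x : word (l1 ++ l2) x = word l1 (word l2 x).
Proof. exact: foldr_cat. Qed.

Lemma wordN l x : word l (- x) = - word l x.
Proof. by elim: l => //= a l ->; rewrite linearN. Qed.

Lemma word_adj l x y : dot (word l x) y = dot x (word (rev l) y).
Proof.
elim: l y => [//|a l IH] y.
by rewrite rev_cons -cats1 word_cat /= refl_adj IH.
Qed.

Lemma word_revK l : cancel (word l) (word (rev l)).
Proof.
elim: l => [//|a l IH] x.
by rewrite rev_cons -cats1 word_cat /= reflK IH.
Qed.

Lemma word_revVK l : cancel (word (rev l)) (word l).
Proof. by move=> x; have := word_revK (rev l) x; rewrite revK. Qed.

Lemma word_conj l a x :
  reflection dot (word l a) (word l x) = word l (reflection dot a x).
Proof. by elim: l => //= b l <-; rewrite refl_conj. Qed.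

End EuclideanReflections.

(** * Finitely generated cones *)

Section Cones.
Context {R : realType} {V : vectType R}.
Implicit Types (t : seq V) (d x y : V).

Definition cone t x : Prop :=
  exists2 c : V -> R, forall a, 0 <= c a & x = \sum_(a <- t) c a *: a.

Lemma coneD t x y : cone t x -> cone t y -> cone t (x + y).
Proof.
move=> [c c0 ->] [e e0 ->]; exists (fun a => c a + e a).
  by move=> a; rewrite addr_ge0.
by rewrite -big_split; apply: eq_bigr => a _; rewrite scalerDl.
Qed.

Lemma coneZ t k x : 0 <= k -> cone t x -> cone t (k *: x).
Proof.
move=> k0 [c c0 ->]; exists (fun a => k * c a).
  by move=> a; rewrite mulr_ge0.
by rewrite scaler_sumr; apply: eq_bigr => a _; rewrite scalerA.
Qed.

Lemma cone_mem t d : uniq t -> d \in t -> cone t d.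
Proof.
move=> ut dt; exists (fun a => (a == d)%:R) => [a|]; first exact: ler0n.
rewrite (bigD1_seq d) //= eqxx scale1r big1 ?addr0 // => a /negbTE ->.
by rewrite scale0r.
Qed.

Lemma cone_remP t d x : d \in t -> cone t x ->
  exists c y, [/\ 0 <= c, cone (rem d t) y & x = c *: d + y].
Proof.
move=> dt [c c0 ->]; exists (c d), (\sum_(a <- rem d t) c a *: a).
by split => //; [exists c | rewrite (big_rem d)].
Qed.

Lemma cone_ge0 t (h : {scalar V}) x :
  (forall a, a \in t -> 0 < h a) -> cone t x -> 0 <= h x.
Proof.
move=> ht [c c0 ->]; rewrite linear_sum big_seq sumr_ge0 // => a /ht ha.
by rewrite linearZ mulr_ge0 // ltW.
Qed.

Lemma cone_eq0 t (h : {scalar V}) x :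
  (forall a, a \in t -> 0 < h a) -> cone t x -> h x = 0 -> x = 0.
Proof.
move=> ht [c c0 ->]; rewrite linear_sum big_seq => /eqP.
rewrite psumr_eq0 => [/allP h0|a /ht ha]; last first.
  by rewrite linearZ mulr_ge0 // ltW.
rewrite big_seq big1 // => a ta; have := h0 a ta.
by rewrite ta linearZ mulf_eq0 (gt_eqF (ht a ta)) orbF => /eqP ->; rewrite scale0r.
Qed.

(** Discarding, one at a time, generators that the others generate leaves the
    cone unchanged. *)
Lemma cone_irredundant t : uniq t ->
  exists t', [/\ uniq t', {subset t' <= t}, forall x, cone t x -> cone t' x
             & forall d, d \in t' -> ~ cone (rem d t') d].
Proof.
move: {2}(size t).+1 (ltnSn (size t)) => n; elim: n t => // n IH t tn ut.
have [[d [dt dc]]|irr] := pselect (exists d, d \in t /\ cone (rem d t) d); last first.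
  by exists t; split=> // d dt dc; apply: irr; exists d.
have [||t' [ut' st' ct' it']] := IH (rem d t).
- by rewrite size_rem //; case: (t) dt tn.
- exact: rem_uniq.
exists t'; split=> // [x /st'|x]; first exact: mem_rem.
move=> /(cone_remP _ _ _ dt)[c [y [c0 cy ->]]]; apply: ct'.
by apply: coneD => //; exact: coneZ.
Qed.

End Cones.

(** * Simple roots *)

Lemma count_ltn (T : eqType) (A B : pred T) (s : seq T) (x : T) :
  subpred A B -> x \in s -> B x -> ~~ A x -> (count A s < count B s)%N.
Proof.
move=> AB + Bx nAx; elim: s => //= y s IH.
rewrite inE => /orP[/eqP <-|/IH lt_s].
  by rewrite (negbTE nAx) Bx add0n add1n ltnS sub_count.
by rewrite -addnS leq_add //; case: (A y) (AB y) => // ->.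
Qed.

Section RootSystems.
Context {R : realType} {V : vectType R} {dot : {dot V for idfun}}.
Context {Phi : set V} (hPhi : root_system dot Phi).
Implicit Types (a b x y rho : V) (l : seq V).

Lemma root_neq0 a : Phi a -> a <> 0.
Proof. by move=> Pa a0; case: hPhi => _ + _ _; apply; rewrite -a0. Qed.

Lemma root_opp a : Phi a -> Phi (- a).
Proof.
move=> Pa; case: hPhi => _ _ /(_ a Pa) red _.
have : [set a; - a] (- a) by right.
by rewrite -red => -[].
Qed.

Lemma root_reduced a c : Phi a -> Phi (c *: a) -> c *: a = a \/ c *: a = - a.
Proof.
move=> Pa Pca; case: hPhi => _ _ /(_ a Pa) red _.
have : (Phi `&` [set c *: a | c in [set: R]]) (c *: a) by split => //; exists c.
by rewrite red.
Qed.

Lemma root_refl a b : Phi a -> Phi b -> Phi (reflection dot a b).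
Proof.
move=> Pa Pb; case: hPhi => _ _ _ /(_ a Pa) stab.
by rewrite -[X in X _]stab; exists b.
Qed.

Lemma root_word l a : (forall b, b \in l -> Phi b) -> Phi a ->
  Phi (word dot l a).
Proof.
elim: l => //= b l IH lP Pa; apply: root_refl; first by apply: lP; rewrite mem_head.
by apply: IH => // c cl; apply: lP; rewrite inE cl orbT.
Qed.

(** Heights are real numbers, but only finitely many of them occur on roots: the
    induction is on the number of roots of smaller height. *)
Lemma root_height_ind rho (P : V -> Prop) :
  (forall a, Phi a -> (forall b, Phi b -> dot rho b < dot rho a -> P b) -> P a) ->
  forall a, Phi a -> P a.
Proof.
move=> IH; have [s sE] : exists s : seq V, Phi = [set` s].
  by case: hPhi => /finite_seqP.
move=> a; pose r a := count (fun b => dot rho b < dot rho a) s.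
move: {2}(r a).+1 (ltnSn (r a)) => n; elim: n a => // n IHn a an Pa.
rewrite ltnS in an; apply: IH => // b Pb ba; apply: IHn => //; apply: leq_trans an.
apply: (@count_ltn _ _ _ _ b) => [x|||] /=.
- by move=> /lt_trans; apply.
- by move: Pb; rewrite sE.
- exact: ba.
- by rewrite ltxx.
Qed.

Section Positive.
Context {rho : V} (hrho : forall a, Phi a -> dot rho a != 0).

Lemma root_pos_or_neg a : Phi a -> 0 < dot rho a \/ 0 < dot rho (- a).
Proof.
move=> Pa; have := hrho a Pa; rewrite dotNr oppr_gt0.
by case: (ltgtP (dot rho a) 0) => // _ _; [right|left].
Qed.

Lemma pos_multiple_eq a c : Phi a -> Phi (c *: a) ->
  0 < dot rho a -> 0 < dot rho (c *: a) -> c *: a = a.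
Proof.
move=> Pa Pca a0 ca0; have [//|E] := root_reduced _ _ Pa Pca.
by move: ca0; rewrite E dotNr oppr_gt0 ltNge ltW.
Qed.

(** These are the walls of the chamber of [rho], encoded by the property that the
    inductions below use; [simple_basis] provides enough of them. *)
Definition simple a := [/\ Phi a, 0 < dot rho a &
  forall b, Phi b -> 0 < dot rho b -> b <> a -> 0 < dot rho (reflection dot a b)].

(** Let [d] be a member of an irredundant generating set, and suppose that the
    reflection in [d] sends a positive root [b <> d] to a negative root.  Then
    a multiple [k *: d] is the sum of the positive roots [b] and [- s_d b].
    Moving the [d]-parts of their expansions to the left expresses [d] by the
    other generators, contrary to irredundancy. *)
Lemma simple_basis : exists t, (forall d, d \in t -> simple d) /\
  forall b, Phi b -> 0 < dot rho b -> cone t b.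
Proof.
have [s sE] : exists s : seq V, Phi = [set` s] by case: hPhi => /finite_seqP.
have [t [ut ts ct it]] :=
  cone_irredundant _ (undup_uniq [seq a <- s | 0 < dot rho a]).
have tpos d : d \in t -> Phi d /\ 0 < dot rho d.
  by move=> /ts; rewrite mem_undup mem_filter sE => /andP[].
have tgen b : Phi b -> 0 < dot rho b -> cone t b.
  move=> Pb b0; apply: ct; apply: cone_mem; first exact: undup_uniq.
  by rewrite mem_undup mem_filter b0 /=; move: Pb; rewrite sE.
exists t; split=> // d dt; have [Pd d0] := tpos d dt; split=> // b Pb b0 bd.
have h0 x : cone (rem d t) x -> 0 <= dot rho x.
  apply: cone_ge0 => a /mem_rem /tpos[]//.
have [//|n0] := root_pos_or_neg _ (root_refl _ _ Pd Pb).
exfalso; apply: (it d dt).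
have [c1 [y1 [c10 cy1 E1]]] := cone_remP _ _ _ dt (tgen _ Pb b0).
have [c2 [y2 [c20 cy2 E2]]] :=
  cone_remP _ _ _ dt (tgen _ (root_opp _ (root_refl _ _ Pd Pb)) n0).
(* [b] and [- s_d b] add up to [k *: d]. *)
set k := 2 * dot b d / dot d d.
have E : (k - c1 - c2) *: d = y1 + y2.
  have kE : k *: d = (c1 *: d + y1) + (c2 *: d + y2).
    by rewrite -E1 -E2 reflectionE opprB addrC subrK.
  by rewrite !scalerBl kE addrACA -[LHS]addrA -opprD addrC addKr.
have hd : dot rho (y1 + y2) = (k - c1 - c2) * dot rho d by rewrite -E dotZr.
(* If [y1] vanished, [b] would be a positive multiple of [d], hence [d]. *)
have y1_gt0 : 0 < dot rho y1.
  rewrite lt_neqAle h0 // andbT eq_sym; apply/eqP => y1h; apply: bd.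
  have y10 : y1 = 0 by apply: (cone_eq0 _ (dot rho)) cy1 y1h => a /mem_rem /tpos[].
  by rewrite E1 y10 addr0; apply: pos_multiple_eq => //; move: Pb b0; rewrite E1 y10 addr0.
have m0 : 0 < k - c1 - c2.
  by rewrite -(pmulr_lgt0 _ d0) -hd dotDr ltr_wpDr // h0.
rewrite -[X in cone _ X](scalerK (lt0r_neq0 m0)) E.
by apply: coneZ; [rewrite invr_ge0 ltW|exact: coneD].
Qed.

(** Otherwise [dot b b], expanded along the simple roots in the second argument,
    would be at most zero. *)
Lemma simple_acute b : Phi b -> 0 < dot rho b ->
  exists2 a, simple a & 0 < dot b a.
Proof.
move=> Pb b0; have [t [ts tgen]] := simple_basis.
have [c c0 bE] := tgen _ Pb b0; apply: contrapT => noa.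
have : 0 < dot b b by apply: dot_gt0; exact: root_neq0.
rewrite [X in dot b X]bE linear_sum ltNge /= big_seq sumr_le0 // => a ta.
rewrite dotZr mulr_ge0_le0 // leNgt; apply/negP => ab.
by apply: noa; exists a => //; apply: ts.
Qed.

(* b minus a positive multiple of a *)
(** Reflecting in a simple root at an acute angle lowers the height: the engine of
    the inductions on height. *)
Lemma refl_lower a b : simple a -> Phi b -> 0 < dot b a ->
  exists2 k, 0 < k & b = reflection dot a b + k *: a.
Proof.
move=> [Pa a0 _] Pb ab; exists (2 * dot b a / dot a a).
  by rewrite divr_gt0 ?mulr_gt0 //; apply: dot_gt0; exact: root_neq0.
by rewrite reflectionE subrK.
Qed.

Lemma simple_step a b : simple a -> Phi b -> 0 < dot rho b ->
  ~ 0 < dot rho (reflection dot a b) -> b = a.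
Proof. by move=> [_ _ h] Pb b0 n0; apply: contrapT => /(h _ Pb b0). Qed.

(** Reflections in simple roots generate all the others: by induction on height,
    [b] is the image under a simple reflection [s_a] of a lower positive root,
    and [s_b] is the corresponding conjugate by [s_a]. *)
Lemma root_refl_word b : Phi b ->
  exists2 l : seq V, forall a, a \in l -> simple a & reflection dot b =1 word dot l.
Proof.
have reflN a : reflection dot (- a) =1 reflection dot a.
  move=> x; rewrite !reflectionE !dotNr dotNl opprK mulrN mulNr.
  by rewrite scalerN scaleNr opprK.
have pos c : Phi c -> 0 < dot rho c ->
    exists2 l : seq V, forall a, a \in l -> simple a & reflection dot c =1 word dot l.
  move: c; apply: (root_height_ind rho) => c Pc IH c0.
  have [a sa ca] := simple_acute _ Pc c0.
  have [->|/eqP ac] := eqVneq c a; first by exists [:: a] => // d; rewrite inE => /eqP ->.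
  have [Pa a0 pa] := sa; have [k k0 cE] := refl_lower _ _ sa Pc ca.
  have [|||l ls lE] := IH (reflection dot a c).
  - exact: root_refl.
  - by rewrite [X in _ < dot rho X]cE dotDr dotZr ltrDl mulr_gt0.
  - exact: pa.
  exists (a :: rcons l a) => [d|x].
    by rewrite inE mem_rcons inE => /orP[/eqP->//|/orP[/eqP->//|/ls]].
  by rewrite /= -cats1 word_cat /= -lE refl_conj reflK.
move=> Pb; have [/(pos _ Pb) //|n0] := root_pos_or_neg _ Pb.
have [l ls lE] := pos _ (root_opp _ Pb) n0.
by exists l => // x; rewrite -lE reflN.
Qed.

(** Apply the letters of [l] to [a] one by one, last letter first: the sign has to
    change at some letter [b], and the simple reflection in [b] makes only [b]
    itself negative. *)
Lemma word_sign_change l a : (forall b, b \in l -> simple b) ->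
  Phi a -> 0 < dot rho a -> ~ 0 < dot rho (word dot l a) ->
  exists l1 b l2, l = l1 ++ b :: l2 /\ word dot l2 a = b.
Proof.
elim: l => [//|b l IH] ls Pa a0 /= n0.
have ls' c : c \in l -> simple c by move=> cl; apply: ls; rewrite inE cl orbT.
have [p|n] := pselect (0 < dot rho (word dot l a)); last first.
  have [l1 [c [l2 [-> E]]]] := IH ls' Pa a0 n.
  by exists (b :: l1), c, l2.
exists [::], b, l; split=> //; apply: simple_step => //.
  by apply: ls; rewrite mem_head.
by apply: root_word => // c /ls'[].
Qed.

(** Deletion: if the last letter is [a], then the word before it must bring [- a]
    back to the positive side, so by [word_sign_change] it contains a letter
    [b = word l2 a] with tail [l2].  By conjugation [s_b] before [l2] cancels
    [s_a] after it, and the word gets shorter by two letters. *)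
Lemma word_pos_id l : (forall b, b \in l -> simple b) ->
  (forall a, Phi a -> 0 < dot rho a -> 0 < dot rho (word dot l a)) ->
  word dot l =1 id.
Proof.
move: {2}(size l).+1 (ltnSn (size l)) => n; elim: n l => // n IH l.
case/lastP: l => [//|l a]; rewrite size_rcons ltnS => ln ls wpos x.
have ls' c : c \in l -> simple c.
  by move=> cl; apply: ls; rewrite mem_rcons inE cl orbT.
have [Pa a0 _] : simple a by apply: ls; rewrite mem_rcons mem_head.
have n0 : ~ 0 < dot rho (word dot l a).
  have := wpos _ Pa a0; rewrite -cats1 word_cat /= (refl_self _ _ (root_neq0 _ Pa)).
  by rewrite wordN dotNr oppr_gt0 => /lt_gtF ->.
have [l1 [b [l2 [lE bE]]]] := word_sign_change _ _ ls' Pa a0 n0.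
have delE : word dot (rcons l a) =1 word dot (l1 ++ l2).
  move=> y; rewrite -cats1 lE !word_cat /= -bE.
  by rewrite word_conj reflK.
rewrite delE; apply: IH => [|c|c Pc c0].
- by apply: leq_trans ln; rewrite lE !size_cat /= addnS.
- by rewrite mem_cat => cl; apply: ls'; rewrite lE mem_cat inE; case/orP: cl => ->; rewrite ?orbT.
- by rewrite -delE; exact: wpos.
Qed.

End Positive.
End RootSystems.

Arguments simple {R V} dot Phi rho a.

(** * Half systems are inversion sets *)

Section HalfSystems.
Context {R : realType} {V : vectType R} {dot : {dot V for idfun}}.
Context {Phi : set V} (hPhi : root_system dot Phi).
Implicit Types (a b x y rho : V) (l : seq V) (I : set V) (w u : 'End(V)).

(** The last condition is closure under positive combinations, in the form in
    which the Condorcet condition provides it. *)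
Definition half_system I :=
  [/\ I `<=` Phi, forall a, Phi a -> I a \/ I (- a), forall a, I a -> ~ I (- a)
    & forall a b c, root_triple Phi a b c -> I a -> I b -> ~ I c].

(** By induction on the height of [b].  If the simple root [a] at an acute angle
    with [b] is not in [I], then the lower positive root [s_a b] is: otherwise
    [b = s_a b + k *: a] would make [b], [- a], [- s_a b] a root-triple in [I]. *)
Lemma half_system_simple rho I b : (forall a, Phi a -> dot rho a != 0) ->
  half_system I -> Phi b -> 0 < dot rho b -> I b ->
  exists2 a, simple dot Phi rho a & I a.
Proof.
move=> hrho [IP Itot Ianti Itri] Pb; move: b Pb.
apply: (root_height_ind hPhi rho) => b Pb IH b0 Ib.
have [a sa ba] := simple_acute hPhi hrho _ Pb b0.
have [[Pa a0 pa] [k k0 bE]] := (sa, refl_lower hPhi _ _ sa Pb ba).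
have [Ia|Ina] := Itot _ Pa; first by exists a.
have [ab|/eqP nba] := eqVneq b a; first by exists a => //; rewrite -ab.
set c := reflection dot a b in bE *.
have Pc : Phi c := root_refl hPhi _ _ Pa Pb.
have c0 : 0 < dot rho c by exact: pa.
have [Ic|Inc] := Itot _ Pc.
  by apply: (IH c) => //; rewrite bE dotDr dotZr ltrDl mulr_gt0.
exfalso; apply: (Itri b (- a) (- c)) => //; split; first by split; [|exact: IP|exact: IP].
split; last first.
  exists 1, k, 1; split; first by split.
  by rewrite !scale1r scalerN {1}bE addrK subrr.
have nz x y : 0 < dot rho x -> 0 < dot rho y -> x <> - y.
  by move=> x0 y0 xy; move: x0; rewrite xy dotNr oppr_gt0 ltNge ltW.
split; [exact: nz|exact: nz|move=> /oppr_inj ac].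
by apply: (nz b a) => //; rewrite -(reflK dot a b) -/c -ac refl_self //; apply: (root_neq0 hPhi).
Qed.

(** By induction on the number of roots of [I] on the positive side of [rho].
    Reflecting [rho] in a simple root [a] of [I] removes [a] from them.  A new
    one would be some [c] in [I] with [- c] positive and made negative by the
    reflection in [a]; that forces [- c = a], but [I] does not contain [- a]. *)
Lemma half_system_chamber rho I : (forall a, Phi a -> dot rho a != 0) ->
  half_system I ->
  exists2 l : seq V, (forall a, a \in l -> Phi a) &
             forall a, I a -> dot (word dot l rho) a < 0.
Proof.
move=> + hI; have [IP Itot Ianti Itri] := hI.
have [s sE] : exists s : seq V, Phi = [set` s].
  by case: hPhi => /finite_seqP.
pose N x := count (fun a => `[< I a >] && (0 < dot x a)) s.
move: {2}(N rho).+1 (ltnSn (N rho)) => n; elim: n rho => // n IH rho.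
rewrite ltnS => Nn hrho.
have [[b [Ib b0]]|noI] := pselect (exists b, I b /\ 0 < dot rho b); last first.
  exists [::] => //= a Ia; rewrite lt_neqAle hrho /= ?leNgt; last exact: IP.
  by apply/negP => a0; apply: noI; exists a.
have [a [Pa a0 pa] Ia] := half_system_simple _ _ _ hrho hI (IP _ Ib) b0 Ib.
pose rho' := reflection dot a rho.
have [|c Pc|l lP lI] := IH rho'.
- apply: leq_trans Nn.
  have sa : a \in s by move: Pa; rewrite sE.
  apply: (@count_ltn _ _ _ _ a) => //= [c /andP[/asboolP Ic]||]; first last.
  - by rewrite refl_adj (refl_self _ _ (root_neq0 hPhi _ Pa)) dotNr oppr_gt0 (lt_gtF a0) andbF.
  - by rewrite a0 asboolT.
  rewrite refl_adj => c0; rewrite asboolT //=.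
  have [//|n0] := root_pos_or_neg hrho _ (IP _ Ic).
  have ca : - c <> a by move=> ca; apply: (Ianti _ Ic); rewrite ca.
  have := pa _ (root_opp hPhi _ (IP _ Ic)) n0 ca.
  by rewrite linearN dotNr oppr_gt0 => /lt_gtF; rewrite c0.
- by rewrite refl_adj; apply: hrho; exact: root_refl.
exists (rcons l a) => [c|c Ic].
  by rewrite mem_rcons inE => /orP[/eqP->//|/lP].
by rewrite -cats1 word_cat; exact: lI.
Qed.

Lemma word_Weyl (l : seq V) : (forall a, a \in l -> Phi a) ->
  exists2 w, Weyl dot Phi w & w =1 word dot l.
Proof.
elim: l => [_|a l IH lP].
  exists \1%VF => [A [[_ A1 _ _] _] //|x]; exact: id_lfunE.
have [|w wW wE] := IH; first by move=> c cl; apply: lP; rewrite inE cl orbT.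
exists (reflection dot a \o w)%VF => [A [gA sA]|x]; last by rewrite comp_lfunE wE.
have [_ _ AM _] := gA; apply: AM; last exact: wW.
by apply: sA; exists a => //; apply: lP; rewrite mem_head.
Qed.

Lemma word_lker0 l w : w =1 word dot l -> lker w == 0%VS.
Proof. by move=> wE; apply/lker0P => x y; rewrite !wE; apply: can_inj (word_revK dot l) x y. Qed.

Lemma word_inv l w : w =1 word dot l -> (w^-1)%VF =1 word dot (rev l).
Proof.
move=> wE x; rewrite -[x in LHS](word_revVK dot l) -wE.
exact: (lker0_lfunK (word_lker0 _ _ wE)).
Qed.

(** * The Weyl group *)

Section WeylGroup.
Context {rho : V} (hrho : forall a, Phi a -> dot rho a != 0).

Lemma Weyl_word w : Weyl dot Phi w ->
  exists2 l : seq V, (forall a, a \in l -> simple dot Phi rho a) & w =1 word dot l.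
Proof.
pose A : set 'End(V) :=
  [set w | exists2 l : seq V, forall a, a \in l -> simple dot Phi rho a
           & (w : 'End(V)) =1 word dot l].
move=> Ww; apply: (Ww A); split; last first.
  by move=> _ [a Pa <-]; apply: (root_refl_word hPhi hrho).
split=> [g [l _ gE]||g h [l ls gE] [m ms hE]|g [l ls gE]].
- exact: word_lker0 gE.
- by exists [::] => // x; rewrite id_lfunE.
- exists (l ++ m) => [a|x].
    by rewrite mem_cat => /orP[/ls|/ms].
  by rewrite comp_lfunE gE hE word_cat.
- exists (rev l) => [a|]; first by rewrite mem_rev => /ls.
  exact: word_inv.
Qed.

Let Pos := Phi `&` [set a | 0 < dot rho a].

Lemma inversionsE (l : seq V) w : (forall a, a \in l -> Phi a) -> w =1 word dot l ->
  inversions Phi Pos w = [set a | Phi a /\ dot (word dot l rho) a < 0].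
Proof.
move=> lP wE; apply/seteqP; rewrite /inversions.
split=> a /= [Pa]; rewrite word_adj (word_inv _ _ wE).
  move=> [Pb nb]; split => //; rewrite lt_neqAle hrho //= leNgt.
  by apply/negP => b0; apply: nb.
move=> n0; split => //; split; last by move=> [_ /=]; rewrite ltNge ltW.
by apply: (root_word hPhi) => // b; rewrite mem_rev => /lP.
Qed.

(** The hypothesis makes [w^-1 u] send positive roots to positive roots. *)
Lemma inversions_sub_inj u w : Weyl dot Phi u -> Weyl dot Phi w ->
  inversions Phi Pos u `<=` inversions Phi Pos w -> u = w.
Proof.
move=> /Weyl_word[l ls uE] /Weyl_word[m ms wE].
have rt (k : seq V) : (forall a, a \in k -> simple dot Phi rho a) -> forall a, a \in k -> Phi a.
  by move=> ks a /ks[].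
rewrite (inversionsE _ _ (rt _ ls) uE) (inversionsE _ _ (rt _ ms) wE) => sub.
suff E : word dot (rev m ++ l) =1 id.
  by apply/lfunP => x; rewrite uE wE -[in RHS](E x) word_cat word_revVK.
apply: (word_pos_id hPhi (rho := rho) (rev m ++ l)) => [a|a Pa a0].
  by rewrite mem_cat mem_rev => /orP[/ms|/ls].
have Pu : Phi (- word dot l a).
  by apply: (root_opp hPhi); apply: (root_word hPhi) => //; exact: rt.
have := sub (- word dot l a); rewrite /= !word_adj !wordN word_revK !dotNr !oppr_lt0.
by rewrite word_cat => /(_ (conj Pu a0))[].
Qed.

(** An element is determined by the list of truth values telling which roots are
    among its inversions. *)
Lemma Weyl_finite : finite_set (Weyl dot Phi).
Proof.
have [s sE] : exists s : seq V, Phi = [set` s] by case: hPhi => /finite_seqP.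
pose F w : (size s).-tuple bool := [tuple of [seq `[< inversions Phi Pos w a >] | a <- in_tuple s]].
have Finj : {in Weyl dot Phi &, injective F}.
  move=> u w /set_mem Wu /set_mem Ww /(congr1 val)/eq_in_map E.
  apply: inversions_sub_inj => // a ua; apply/asboolP; rewrite -E; first exact/asboolP.
  by case: ua; rewrite sE.
by rewrite -(eq_finite_set (inj_card_eq Finj)); exact: finite_finset.
Qed.

Lemma half_system_inversions I : half_system I ->
  exists2 w, Weyl dot Phi w & inversions Phi Pos w = I.
Proof.
move=> hI; have [l lP lI] := half_system_chamber _ _ hrho hI.
have [w Ww wE] := word_Weyl _ lP; exists w => //.
rewrite (inversionsE _ _ lP wE); have [IP Itot _ _] := hI.
apply/seteqP; split=> [a /= [Pa n0]|a Ia]; last by split; [exact: IP|exact: lI].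
by have [//|/lI] := Itot _ Pa; rewrite dotNr oppr_lt0 ltNge ltW.
Qed.

End WeylGroup.
End HalfSystems.

(** * Majority voting on a Condorcet domain *)

Section Voting.
Context {R : realType} {V : vectType R} {dot : {dot V for idfun}}.
Context {Phi : set V} (hPhi : root_system dot Phi).
Context {rho : V} (hrho : forall a, Phi a -> dot rho a != 0).
Let Pos := Phi `&` [set a | 0 < dot rho a].
Local Notation Inv := (inversions Phi Pos).

(** Inversion sets are the half spaces cut out by the vectors in the orbit of
    [rho]. *)
Lemma Weyl_inversionsE w : Weyl dot Phi w ->
  exists x, (forall a, Phi a -> dot x a != 0) /\
            Inv w = [set a | Phi a /\ dot x a < 0].
Proof.
move=> /(Weyl_word hPhi hrho)[l ls wE].
have lP a : a \in l -> Phi a by move=> /ls[].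
exists (word dot l rho); split; last exact: (inversionsE hPhi hrho _ _ lP wE).
move=> a Pa; rewrite word_adj; apply: hrho; apply: (root_word hPhi) => // b.
by rewrite mem_rev => /lP.
Qed.

Lemma inversionsN w a : Weyl dot Phi w -> Phi a -> Inv w (- a) <-> ~ Inv w a.
Proof.
move=> /Weyl_inversionsE[x [x0 ->]] Pa /=; rewrite dotNr oppr_lt0; split.
  by move=> [_ a0] [_]; rewrite ltNge ltW.
move=> H; split; first exact: (root_opp hPhi).
by rewrite lt_neqAle eq_sym x0 // leNgt; apply/negP => a0; apply: H.
Qed.

Lemma inversions_triple w a b c : Weyl dot Phi w -> root_triple Phi a b c ->
  Inv w a -> Inv w b -> ~ Inv w c.
Proof.
move=> /Weyl_inversionsE[u [_ ->]] [_ [_ [x [y [z [[x0 y0 z0] E]]]]]] [_ a0] [_ b0] [_ c0].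
suff : dot u (x *: a + y *: b + z *: c) < 0 by rewrite E linear0 ltxx.
by rewrite !dotDr !dotZr -oppr_gt0 !opprD !addr_gt0 // oppr_gt0 pmulr_rlt0.
Qed.

Context {D : set 'End(V)} (hD : condorcet_domain dot Phi Pos D).
Implicit Types (f : D -> nat) (a b c : V).

Lemma domain_Weyl (w : D) : Weyl dot Phi (val w).
Proof. by case: hD => _ + _; apply; apply: set_mem; apply: valP. Qed.

Lemma domain_finite : finite_set [set: D].
Proof.
rewrite (eq_finite_set (card_setT D)); case: hD => _ DW _.
exact: sub_finite_set DW (Weyl_finite hPhi hrho).
Qed.

Lemma votesE f a : votes Phi Pos f a =
  (\sum_(w <- fset_set [set: D] | `[< Inv (val w) a >]) f w)%N.
Proof.
rewrite /votes fsbig_mkcond fsbig_finite; last exact: domain_finite.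
rewrite [RHS]big_mkcond; apply: eq_bigr => w _.
by rewrite /patch unfold_in.
Qed.

Lemma total_votesE f : total_votes f = (\sum_(w <- fset_set [set: D]) f w)%N.
Proof. by rewrite /total_votes fsbig_finite //; exact: domain_finite. Qed.

Lemma votesN f a : Phi a ->
  (votes Phi Pos f a + votes Phi Pos f (- a))%N = total_votes f.
Proof.
move=> Pa; rewrite !votesE total_votesE [RHS](bigID (fun w => `[< Inv (val w) a >])) /=.
congr (_ + _)%N; apply: eq_bigl => w; rewrite -asbool_neg.
by apply: asbool_equiv_eq; apply: inversionsN => //; exact: domain_Weyl.
Qed.

Lemma votes_pigeonhole f a b :
  (total_votes f < votes Phi Pos f a + votes Phi Pos f b)%N ->
  exists w : D, Inv (val w) a /\ Inv (val w) b.
Proof.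
move=> lt_ab; apply: contrapT => no; move: lt_ab; apply/negP; rewrite -leqNgt.
rewrite !votesE total_votesE !(big_mkcond (fun w => `[< _ >])) -big_split.
apply: leq_sum => w _ /=; case: asboolP => wa; case: asboolP => wb; rewrite ?addn0 //.
by exfalso; apply: no; exists w.
Qed.

(** The thresholds in [R] become statements on natural numbers, where parity can be
    used. *)
Lemma preferenceE f a : preference Phi Pos f a <->
  Phi a /\ (total_votes f <= 2 * votes Phi Pos f a)%N.
Proof.
by rewrite /preference /= ler_pdivrMr // mulrC -natrM ler_nat.
Qed.

Lemma no_tieP f : no_tie Phi Pos f <->
  forall a, Phi a -> (2 * votes Phi Pos f a)%N <> total_votes f.
Proof.
suff E a : (votes Phi Pos f a)%:R = (total_votes f)%:R / 2 :> R <->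
    (2 * votes Phi Pos f a)%N = total_votes f.
  by split=> h a Pa /E; apply: h.
split=> [E|<-]; last by rewrite natrM mulrAC divff ?mul1r ?pnatr_eq0.
by apply/eqP; rewrite -(eqr_nat R) natrM E mulrC divfK ?pnatr_eq0.
Qed.

(** Without ties every root of the preference has a strict majority, so two of them
    always have a common voter. *)
Lemma preference_half_system f : no_tie Phi Pos f ->
  half_system (Phi := Phi) (preference Phi Pos f).
Proof.
move=> /no_tieP nt; have vN := votesN f; split.
- by move=> a [].
- move=> a Pa; rewrite !preferenceE; have := vN a Pa.
  by case: (leqP (total_votes f) (2 * votes Phi Pos f a)) => h E;
    [left|right]; split => //; [exact: (root_opp hPhi)|lia].
- move=> a /preferenceE[Pa h] /preferenceE[_ h'].
  by have := vN a Pa; have := nt a Pa; lia.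
move=> a b c abc.
have maj d : preference Phi Pos f d -> (total_votes f < 2 * votes Phi Pos f d)%N.
  by move=> /preferenceE[Pd]; have := nt d Pd; lia.
move=> /maj ma /maj mb /maj mc.
have [|u [ua ub]] := @votes_pigeonhole f a b; first by lia.
have [|v [va vc]] := @votes_pigeonhole f a c; first by lia.
have [|w [wb wc]] := @votes_pigeonhole f b c; first by lia.
have no (x : D) : Inv (val x) a -> Inv (val x) b -> ~ Inv (val x) c.
  exact: inversions_triple _ _ _ _ (domain_Weyl x) abc.
case: hD => _ _; apply; exists (val u), (val v), (val w), a, b, c.
split; first by split; apply: set_mem; apply: valP.
split; last by [].
split=> E.
- by apply: (no u) => //; rewrite E.
- by apply: (no u) => //; rewrite E.
- by apply: (no v) => //; rewrite E.
Qed.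

(** The total [2 * t + 1] is odd, so the doubled profile with one voter [w0] added
    has no tie; the extra vote counts half as much as a vote of [f], too little
    to give a root a majority that [f] denies it. *)
Lemma tie_break f : exists g : D -> nat, no_tie Phi Pos g /\
  preference Phi Pos g `<=` preference Phi Pos f.
Proof.
have [w0 Dw0] : D !=set0 by case: hD.
pose v0 : D := SigSub (mem_set Dw0).
pose one (w : D) : nat := w == v0.
pose g w := (2 * f w + one w)%N.
have one1 : (\sum_(w <- fset_set [set: D]) one w = 1)%N.
  rewrite (bigD1_seq v0) ?fset_uniq //=; last first.
    by rewrite in_fset_set ?in_setT //; exact: domain_finite.
  by rewrite /one eqxx big1 // => w /negbTE ->.
have totg : total_votes g = (2 * total_votes f).+1.
  by rewrite !total_votesE big_split big_distrr /= one1 addn1.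
have votg a : (votes Phi Pos g a <= (2 * votes Phi Pos f a).+1)%N.
  rewrite !votesE big_split big_distrr /= -[leqRHS]addn1 leq_add2l -one1.
  by rewrite [leqRHS](bigID (fun w => `[< Inv (val w) a >])) leq_addr.
exists g; split.
  by apply/no_tieP => a _; rewrite totg; lia.
move=> a /preferenceE[Pa]; rewrite totg => h; apply/preferenceE; split => //.
by have := votg a; lia.
Qed.

End Voting.

Theorem theorem1p2 (R : realType) (V : vectType R) (dot : {dot V for idfun})
    (Phi Pos : set V)
    (hPhi : root_system dot Phi) (hPos : positive_system dot Phi Pos)
    (D : set 'End(V)) (hD : condorcet_domain dot Phi Pos D)
    (f : D -> nat) (hf : profile f) :
  majority_result dot Phi Pos f !=set0 /\
  (no_tie Phi Pos f ->
   exists w : 'End(V),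
     [/\ Weyl dot Phi w,
         inversions Phi Pos w = preference Phi Pos f
       & majority_result dot Phi Pos f = [set w]]).
Proof.
have [rho hrho PosE] := hPos; rewrite {}PosE {hPos} in hD *.
split=> [|nt].
  have [g [nt gf]] := tie_break hPhi hrho hD f.
  have [w Ww wE] := half_system_inversions hPhi hrho _ (preference_half_system hPhi hrho hD _ nt).
  by exists w; split => //; rewrite wE.
have [w Ww wE] := half_system_inversions hPhi hrho _ (preference_half_system hPhi hrho hD _ nt).
exists w; split => //; apply/seteqP; split=> [u [Wu]|_ ->]; last by split => //; rewrite wE.
by rewrite -wE; apply: (inversions_sub_inj hPhi hrho).
Qed.
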